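(* For every real number $\alpha$ with $0<\alpha<1$, $$2\int_0^\infty \frac{\arctan(\alpha x)}{1+x^2}\,dx=\log\alpha\,\log\frac{1-\alpha}{1+\alpha}+\mathrm{Li}_2(\alpha)-\mathrm{Li}_2(-\alpha).$$
   Context: $\mathrm{Li}_2(\alpha)=\sum_{n=1}^\infty \frac{\alpha^n}{n^2}$ for $|\alpha|\le 1$ is the dilogarithm. *)

(* Defs.v *)
From Stdlib Require Import Reals Lra Lia.
From Coquelicot Require Import Coquelicot.
Open Scope R_scope.

(* [Series] sums from index 0, hence the shift n = S k in a^n / n^2. *)
Definition Li2_term (a : R) (k : nat) : R := a ^ (S k) / (INR (S k)) ^ 2.

(* The real dilogarithm; meaningful for |a| <= 1, see [ex_series_Li2]. *)
Definition Li2 (a : R) : R := Series (Li2_term a).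

Lemma ex_series_inv_sq : ex_series (fun k => / (INR (S k)) ^ 2).
Proof.
apply ex_finite_lim_seq_incr with (M := 2).
- intros n; rewrite sum_Sn; unfold plus; cbn -[INR pow].
  assert (0 < / INR (S (S n)) ^ 2); [|lra].
  apply Rinv_0_lt_compat, pow_lt, lt_0_INR; lia.
- intros n.
  apply Rle_trans with (2 - / INR (S n)); cycle 1.
  { assert (0 < / INR (S n)) by (apply Rinv_0_lt_compat, lt_0_INR; lia); lra. }
  induction n as [|n IH].
  + rewrite sum_O; change (INR 1) with 1.
    replace (/ 1 ^ 2) with 1 by field; lra.
  + rewrite sum_Sn; unfold plus; cbn -[INR pow].
    assert (Hn : 0 < INR (S n)) by (apply lt_0_INR; lia).
    rewrite (S_INR (S n)).
    set (x := INR (S n)) in *.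
    assert (E : / x - / (x + 1) - / (x + 1) ^ 2 = / (x * (x + 1) ^ 2))
      by (field; lra).
    assert (0 < / (x * (x + 1) ^ 2)).
    { apply Rinv_0_lt_compat, Rmult_lt_0_compat; [lra | apply pow_lt; lra]. }
    apply Rle_trans with (2 - / x + / (x + 1) ^ 2);
      [apply Rplus_le_compat_r; exact IH | lra].
Qed.

Lemma ex_series_Li2 (a : R) : Rabs a <= 1 -> ex_series (Li2_term a).
Proof.
intros Ha.
apply (ex_series_le (Li2_term a) (fun k => / (INR (S k)) ^ 2));
  [|exact ex_series_inv_sq].
intros k; unfold Li2_term, norm; cbn -[INR pow].
assert (Hk : 0 < / INR (S k) ^ 2)
  by (apply Rinv_0_lt_compat, pow_lt, lt_0_INR; lia).
change (Rabs (a ^ S k / INR (S k) ^ 2) <= / INR (S k) ^ 2).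
unfold Rdiv; rewrite Rabs_mult, (Rabs_pos_eq (/ _)), <- RPow_abs by lra.
assert (Rabs a ^ S k <= 1).
{ rewrite <- (pow1 (S k)); apply pow_incr; split; [apply Rabs_pos | exact Ha]. }
nra.
Qed.

(* Main.v *)
(** Write F(a) for the integral. Pointwise, for 0 < a < b and x > 0,
    (b - a) x / (1 + b^2 x^2) <= atan (b x) - atan (a x) <= (b - a) x / (1 + a^2 x^2);
    dividing by 1 + x^2 and integrating over the half-line gives
    (b - a) phi(b) <= F(b) - F(a) <= (b - a) phi(a) with phi(a) = - ln a / (1 - a^2).
    As phi is continuous, F' = phi on (0, 1), without differentiating under the
    integral sign. The right-hand side has derivative 2 phi, and both sides tend
    to 0 at 0+. *)

Require Import Defs.
From Stdlib Require Import Reals Lra Lia.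
From Coquelicot Require Import Coquelicot.
Open Scope R_scope.

(** * Preliminaries on derivatives and improper integrals *)

Lemma ln_le_sub1 (x : R) : 0 < x -> ln x <= x - 1.
Proof.
intros Hx.
generalize (exp_ineq1_le (ln x)); rewrite exp_ln by exact Hx; lra.
Qed.

(** The difference quotient at [a] lies between [phi a] and [phi (a + h)], so continuity of [phi]
    squeezes it to [phi a]. *)
Lemma is_derive_sandwich (F phi : R -> R) (lo hi a : R) :
  lo < a < hi -> continuity_pt phi a ->
  (forall x y, lo < x -> x < y -> y < hi ->
     (y - x) * phi y <= F y - F x <= (y - x) * phi x) ->
  is_derive F a (phi a).
Proof.
intros Ha Hc HF; apply is_derive_Reals; intros eps Heps.
destruct (Hc eps Heps) as [d [Hd Hphi]].
assert (Hm : 0 < Rmin d (Rmin (a - lo) (hi - a)))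
  by (repeat apply Rmin_glb_lt; lra).
exists (mkposreal _ Hm); simpl; intros h Hh0 Hh.
assert (B : Rabs h < d /\ Rabs h < a - lo /\ Rabs h < hi - a).
{ generalize (Rmin_l d (Rmin (a - lo) (hi - a))) (Rmin_r d (Rmin (a - lo) (hi - a)))
    (Rmin_l (a - lo) (hi - a)) (Rmin_r (a - lo) (hi - a)); lra. }
destruct B as [B1 [B2 B3]].
assert (P : Rabs (phi (a + h) - phi a) < eps).
{ apply Hphi; split.
  - split; [exact I | lra].
  - simpl; unfold Rdist; replace (a + h - a) with h by ring; exact B1. }
apply Rabs_def2 in P.
set (q := (F (a + h) - F a) / h).
assert (Hq : F (a + h) - F a = h * q) by (unfold q; field; exact Hh0).
apply Rabs_def2 in B2; apply Rabs_def2 in B3.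
(* For h < 0 the increment bound is applied to the pair (a + h, a), which swaps the roles of the two
   bounds on [q]. *)
destruct (Rdichotomy _ _ Hh0) as [Hn | Hp].
- assert (S := HF (a + h) a ltac:(lra) ltac:(lra) ltac:(lra)).
  assert (phi a <= q <= phi (a + h)) by (split; nra).
  apply Rabs_def1; lra.
- assert (S := HF a (a + h) ltac:(lra) ltac:(lra) ltac:(lra)).
  assert (phi (a + h) <= q <= phi a) by (split; nra).
  apply Rabs_def1; lra.
Qed.

(** Since the singleton {a} belongs to [at_point a], the limit over two filters reduces to one in
    the upper endpoint alone. *)
Lemma is_RInt_gen_at_point_p_infty (f : R -> R) (a l : R) :
  (forall M, ex_RInt f a M) ->
  filterlim (RInt f a) (Rbar_locally p_infty) (locally l) ->
  is_RInt_gen f (at_point a) (Rbar_locally p_infty) l.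
Proof.
intros Hex Hl P HP.
specialize (Hl P HP).
exists (fun x => x = a) (fun M => P (RInt f a M)); [reflexivity | exact Hl |].
intros x M -> HM; exists (RInt f a M); split; [|exact HM].
apply (RInt_correct (V := R_CompleteNormedModule)), Hex.
Qed.

(** * Logarithm and dilogarithm series *)

(** With this index shift, x times the power series is the polylogarithm of order p: x / (1 - x), -
    ln (1 - x) and Li2 for p = 0, 1, 2. *)
Definition inv_pow (p k : nat) : R := / INR (S k) ^ p.

Lemma CV_radius_inv_pow (p : nat) (x : R) :
  Rabs x < 1 -> Rbar_lt (Rabs x) (CV_radius (inv_pow p)).
Proof.
intros Hx; apply Rbar_lt_le_trans with 1; [exact Hx|].
apply (proj1 (CV_radius_bounded (inv_pow p))).
exists 1; intros n; rewrite pow1, Rmult_1_r; unfold inv_pow.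
assert (1 <= INR (S n) ^ p).
{ apply pow_R1_Rle; rewrite S_INR; generalize (pos_INR n); lra. }
rewrite Rabs_pos_eq.
- rewrite <- Rinv_1; apply Rinv_le_contravar; lra.
- left; apply Rinv_0_lt_compat; lra.
Qed.

(** Multiplying by t shifts the coefficients by one; differentiating then multiplies the n-th by n +
    1, lowering the exponent from p + 1 to p. *)
Lemma is_derive_PSeries_inv_pow (p : nat) (x : R) : Rabs x < 1 ->
  is_derive (fun t => t * PSeries (inv_pow (S p)) t) x (PSeries (inv_pow p) x).
Proof.
intros Hx.
apply is_derive_ext with (PSeries (PS_incr_1 (inv_pow (S p)))).
{ intros t; apply PSeries_incr_1. }
replace (PSeries (inv_pow p) x)
  with (PSeries (PS_derive (PS_incr_1 (inv_pow (S p)))) x).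
- apply is_derive_PSeries; rewrite CV_radius_incr_1.
  apply CV_radius_inv_pow, Hx.
- apply PSeries_ext; intros n; unfold PS_derive, PS_incr_1, inv_pow.
  assert (INR (S n) <> 0) by (apply not_0_INR; lia).
  assert (INR (S n) ^ p <> 0) by (apply pow_nonzero; assumption).
  change (INR (S n) ^ S p) with (INR (S n) * INR (S n) ^ p).
  field; split; assumption.
Qed.

Lemma PSeries_inv_pow_0 (x : R) : Rabs x < 1 -> PSeries (inv_pow 0) x = / (1 - x).
Proof.
intros Hx; rewrite <- Series_geom by exact Hx.
apply Series_ext; intros n; unfold inv_pow; simpl; field.
Qed.

(** The difference [D] of the two sides has zero derivative on (-1, 1) by the geometric series, and
    vanishes at 0. *)
Lemma ln_series (x : R) : Rabs x < 1 -> x * PSeries (inv_pow 1) x = - ln (1 - x).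
Proof.
intros Hx.
set (D := fun t => t * PSeries (inv_pow 1) t + ln (1 - t)).
assert (D0 : D 0 = 0).
{ unfold D; replace (1 - 0) with 1 by ring; rewrite ln_1; ring. }
assert (Hd : forall t, Rabs t < 1 -> is_derive D t 0).
{ intros t Ht.
  replace 0 with (PSeries (inv_pow 0) t + - / (1 - t))
    by (rewrite PSeries_inv_pow_0 by exact Ht; ring).
  refine (is_derive_plus (V := R_NormedModule)
    (fun t => t * PSeries (inv_pow 1) t) (fun t => ln (1 - t)) t _ _ _ _).
  - apply is_derive_PSeries_inv_pow, Ht.
  - apply Rabs_def2 in Ht; auto_derive; [lra | field; lra]. }
enough (D x = 0) by (unfold D in *; lra).
apply Rabs_def2 in Hx.
destruct (Rtotal_order x 0) as [Hn | [-> | Hp]].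
- rewrite <- D0; apply (eq_is_derive D); [|exact Hn].
  intros t Ht; apply Hd, Rabs_def1; lra.
- exact D0.
- rewrite <- D0; symmetry; apply (eq_is_derive D); [|exact Hp].
  intros t Ht; apply Hd, Rabs_def1; lra.
Qed.

Lemma Li2_PSeries (x : R) : Li2 x = x * PSeries (inv_pow 2) x.
Proof.
unfold Li2, PSeries; rewrite <- Series_scal_l.
apply Series_ext; intros n; unfold Li2_term, inv_pow, Rdiv; simpl pow; ring.
Qed.

Lemma is_derive_Li2 (x : R) : Rabs x < 1 -> x <> 0 ->
  is_derive Li2 x (- ln (1 - x) / x).
Proof.
intros Hx Hx0.
apply is_derive_ext with (fun t => t * PSeries (inv_pow 2) t).
{ intros t; symmetry; apply Li2_PSeries. }
replace (- ln (1 - x) / x) with (PSeries (inv_pow 1) x).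
- apply is_derive_PSeries_inv_pow, Hx.
- rewrite <- ln_series by exact Hx; field; exact Hx0.
Qed.

Lemma Li2_0 : Li2 0 = 0.
Proof. rewrite Li2_PSeries; ring. Qed.

Lemma continuous_Li2_0 : continuous Li2 0.
Proof.
apply (ex_derive_continuous Li2); exists (PSeries (inv_pow 1) 0).
apply is_derive_ext with (fun t => t * PSeries (inv_pow 2) t).
{ intros t; symmetry; apply Li2_PSeries. }
apply is_derive_PSeries_inv_pow; rewrite Rabs_R0; lra.
Qed.

(** * The arctangent integral *)

(** Mean value theorem, with 1 / (1 + t^2) decreasing for t >= 0. *)
Lemma atan_increment (u v : R) : 0 <= u -> u <= v ->
  (v - u) / (1 + v ^ 2) <= atan v - atan u <= (v - u) / (1 + u ^ 2).
Proof.
intros Hu Huv.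
destruct (MVT_gen atan u v (fun t => / (1 + t ^ 2))) as [c [Hc E]].
- intros t _; apply is_derive_Reals, derivable_pt_lim_atan.
- intros t _; apply derivable_continuous_pt, derivable_pt_atan.
- rewrite Rmin_left, Rmax_right in Hc by exact Huv; rewrite E.
  assert (/ (1 + v ^ 2) <= / (1 + c ^ 2) <= / (1 + u ^ 2))
    by (split; apply Rinv_le_contravar; nra).
  unfold Rdiv; nra.
Qed.

Lemma atan_nonneg (x : R) : 0 <= x -> 0 <= atan x.
Proof.
intros Hx; rewrite <- atan_0.
destruct Hx as [Hx | <-]; [left; apply atan_increasing, Hx | right; reflexivity].
Qed.

Lemma atan_le_id (x : R) : 0 <= x -> atan x <= x.
Proof.
intros Hx; generalize (proj2 (atan_increment 0 x (Rle_refl 0) Hx)).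
rewrite atan_0; replace (1 + 0 ^ 2) with 1 by ring; lra.
Qed.

(** Here atan M < pi/2, and pi/2 - atan T = atan (1/T) <= 1/T. *)
Lemma atan_tail (T M : R) : 0 < T -> atan M - atan T <= / T.
Proof.
intros HT.
assert (0 < / T) by (apply Rinv_0_lt_compat, HT).
generalize (atan_inv T HT) (atan_le_id (/ T) ltac:(lra)) (atan_bound M); lra.
Qed.

Definition atan_integrand (a x : R) : R := atan (a * x) / (1 + x ^ 2).

Definition atan_integral (a M : R) : R := RInt (atan_integrand a) 0 M.

Lemma ex_RInt_atan_integrand (a u v : R) : ex_RInt (atan_integrand a) u v.
Proof.
apply (ex_RInt_continuous (V := R_CompleteNormedModule)); intros z _.
apply (ex_derive_continuous (atan_integrand a)); unfold atan_integrand.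
auto_derive; nra.
Qed.

Lemma is_RInt_inv_1_sq (c u v : R) :
  is_RInt (fun x => c / (1 + x ^ 2)) u v (c * (atan v - atan u)).
Proof.
replace (c * (atan v - atan u)) with (minus (c * atan v) (c * atan u))
  by (unfold minus, plus, opp; simpl; ring).
apply (is_RInt_derive (fun x => c * atan x)); intros x _.
- auto_derive; [exact I | field; nra].
- apply (ex_derive_continuous (fun x => c / (1 + x ^ 2))); auto_derive; nra.
Qed.

(** On the range of integration the arctangent lies between 0 and pi/2, and pi/2 <= 2. The lower
    bound gives monotonicity in the upper endpoint, the upper bound controls the tail. *)
Lemma atan_integral_increment (a T M : R) : 0 < a -> 0 <= T -> T <= M ->
  0 <= atan_integral a M - atan_integral a T <= 2 * (atan M - atan T).
Proof.
intros Ha HT HM.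
assert (C := RInt_Chasles (atan_integrand a) 0 T M
  (ex_RInt_atan_integrand a 0 T) (ex_RInt_atan_integrand a T M)).
unfold plus in C; simpl in C; unfold atan_integral.
replace (RInt (atan_integrand a) 0 M - RInt (atan_integrand a) 0 T)
  with (RInt (atan_integrand a) T M) by lra.
assert (Hint := RInt_correct _ _ _ (ex_RInt_atan_integrand a T M)).
assert (B : forall x, T < x < M -> 0 <= atan (a * x) <= 2).
{ intros x Hx; split; [apply atan_nonneg; nra |].
  generalize (atan_bound (a * x)) PI_4; lra. }
split.
- replace 0 with (0 * (atan M - atan T)) by ring.
  apply (is_RInt_le _ _ T M _ _ HM (is_RInt_inv_1_sq 0 T M) Hint).
  intros x Hx; apply Rmult_le_compat_r; [|apply B, Hx].
  left; apply Rinv_0_lt_compat; nra.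
- apply (is_RInt_le _ _ T M _ _ HM Hint (is_RInt_inv_1_sq 2 T M)).
  intros x Hx; apply Rmult_le_compat_r; [|apply B, Hx].
  left; apply Rinv_0_lt_compat; nra.
Qed.

(** The integrand is at most a x / (1 + x^2) <= a. This bound is sharp enough on short ranges when
    [a] is small. *)
Lemma atan_integral_le (a T : R) : 0 < a -> 0 <= T -> atan_integral a T <= a * T.
Proof.
intros Ha HT.
assert (Hint := RInt_correct _ _ _ (ex_RInt_atan_integrand a 0 T)).
assert (Hcst := is_RInt_const 0 T a).
replace (a * T) with (scal (T - 0) a)
  by (unfold scal; simpl; unfold mult; simpl; ring).
apply (is_RInt_le _ _ 0 T _ _ HT Hint Hcst).
intros x Hx; unfold atan_integrand.
assert (A := atan_le_id (a * x) ltac:(nra)).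
apply Rmult_le_reg_r with (1 + x ^ 2); [nra|].
replace (atan (a * x) / (1 + x ^ 2) * (1 + x ^ 2)) with (atan (a * x))
  by (field; nra).
assert (x <= 1 + x ^ 2) by nra.
nra.
Qed.

Lemma atan_integral_cv (a : R) : 0 < a ->
  exists l, filterlim (atan_integral a) (Rbar_locally p_infty) (locally l).
Proof.
intros Ha.
apply (Hierarchy.filterlim_locally_cauchy (U := R_CompleteNormedModule)).
(* Beyond u = 4 / eps the increment is at most 2 / u < eps / 2. *)
intros [eps Heps]; exists (fun M => 4 / eps < M); split.
{ exists (4 / eps); intros M HM; exact HM. }
assert (H4 : 0 < 4 / eps) by (apply Rdiv_lt_0_compat; lra).
assert (K : forall u v, 4 / eps < u -> u <= v ->
  Rabs (atan_integral a v - atan_integral a u) < eps).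
{ intros u v Hu Huv.
  assert (I := atan_integral_increment a u v Ha ltac:(lra) Huv).
  assert (A := atan_tail u v ltac:(lra)).
  assert (/ u < / (4 / eps)) by (apply Rinv_lt_contravar; nra).
  replace (/ (4 / eps)) with (eps / 4) in * by (field; lra).
  apply Rabs_def1; lra. }
intros u v Hu Hv.
change (Rabs (atan_integral a v - atan_integral a u) < eps).
destruct (Rle_dec u v) as [H | H].
- apply K; assumption.
- rewrite Rabs_minus_sym; apply K; [exact Hv | lra].
Qed.

Definition atan_integral_lim (a : R) : R :=
  RInt_gen (atan_integrand a) (at_point 0) (Rbar_locally p_infty).

Lemma ex_RInt_gen_atan_integrand (a : R) : 0 < a ->
  ex_RInt_gen (atan_integrand a) (at_point 0) (Rbar_locally p_infty).
Proof.
intros Ha; destruct (atan_integral_cv a Ha) as [l Hl]; exists l.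
apply is_RInt_gen_at_point_p_infty; [|exact Hl].
intros M; apply ex_RInt_atan_integrand.
Qed.

(** The limit is taken along M = n + 1, so that inequalities pass to limits of sequences and 1 / M
    makes sense at every index. *)
Lemma atan_integral_lim_seq (a : R) : 0 < a ->
  is_lim_seq (fun n => atan_integral a (INR (S n))) (atan_integral_lim a).
Proof.
intros Ha; destruct (atan_integral_cv a Ha) as [l Hl].
replace (atan_integral_lim a) with l.
- refine (filterlim_comp _ _ _ (fun n => INR (S n)) (atan_integral a) _ _ _ _ Hl).
  apply (is_lim_seq_incr_1 INR p_infty), is_lim_seq_INR.
- symmetry; apply is_RInt_gen_unique.
  apply is_RInt_gen_at_point_p_infty; [|exact Hl].
  intros M; apply ex_RInt_atan_integrand.
Qed.

(** * The rational kernel and the derivative of the integral in its parameter *)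

Definition kernel_integral (a M : R) : R :=
  (ln (1 + M ^ 2) - ln (1 + (a * M) ^ 2)) / (2 * (1 - a ^ 2)).

(** Partial fractions: (1 - a^2) x / ((1 + a^2 x^2) (1 + x^2)) equals x / (1 + x^2) - a^2 x / (1 +
    a^2 x^2), whose primitive is a difference of logarithms. *)
Lemma is_RInt_kernel (a c M : R) : 0 < a < 1 ->
  is_RInt (fun x => c * (x / (1 + (a * x) ^ 2)) / (1 + x ^ 2)) 0 M
    (c * kernel_integral a M).
Proof.
intros Ha.
assert (Hpos : forall x, 0 < 1 + (a * x) ^ 2) by (intros x; nra).
replace (c * kernel_integral a M)
  with (minus (c * kernel_integral a M) (c * kernel_integral a 0)).
- apply (is_RInt_derive (fun x => c * kernel_integral a x)); intros x _.
  + unfold kernel_integral; specialize (Hpos x); auto_derive.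
    * repeat split; nra.
    * field; repeat split; nra.
  + apply (ex_derive_continuous
      (fun x => c * (x / (1 + (a * x) ^ 2)) / (1 + x ^ 2))).
    specialize (Hpos x); auto_derive; repeat split; nra.
- unfold kernel_integral, minus, plus, opp; simpl.
  replace (a * 0 * (a * 0 * 1)) with 0 by ring.
  replace (0 * (0 * 1)) with 0 by ring.
  field; nra.
Qed.

Definition phi (a : R) : R := - ln a / (1 - a ^ 2).

(** Factoring M^2 out of both logarithms turns the expression into [g] at t = 1 / M; [g] is
    continuous at 0, where its value is [phi a]. *)
Lemma kernel_integral_lim_seq (a : R) : 0 < a < 1 ->
  is_lim_seq (fun n => kernel_integral a (INR (S n))) (phi a).
Proof.
intros Ha.
set (g := fun t => (ln (t ^ 2 + 1) - ln (t ^ 2 + a ^ 2)) / (2 * (1 - a ^ 2))).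
replace (phi a) with (g 0).
- apply is_lim_seq_ext with (fun n => g (/ INR (S n))).
  + intros n; assert (Hn : 0 < INR (S n)) by (apply lt_0_INR; lia).
    set (m := INR (S n)) in *.
    assert (0 < / m) by (apply Rinv_0_lt_compat, Hn).
    unfold g, kernel_integral; f_equal.
    replace (1 + m ^ 2) with (m ^ 2 * ((/ m) ^ 2 + 1)) by (field; lra).
    replace (1 + (a * m) ^ 2) with (m ^ 2 * ((/ m) ^ 2 + a ^ 2)) by (field; lra).
    rewrite !ln_mult by nra; ring.
  + apply is_lim_seq_continuous.
    * apply continuity_pt_filterlim, (ex_derive_continuous g); unfold g.
      auto_derive; repeat split; nra.
    * apply (is_lim_seq_incr_1 (fun n => / INR n)).
      replace (Finite 0) with (Rbar_inv p_infty) by reflexivity.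
      apply is_lim_seq_inv; [apply is_lim_seq_INR | discriminate].
- unfold g, phi; replace (0 ^ 2 + 1) with 1 by ring.
  replace (0 ^ 2 + a ^ 2) with (a * a) by ring.
  rewrite ln_1, ln_mult by lra; field; nra.
Qed.

Lemma atan_integral_lim_increment (a b : R) : 0 < a -> a < b -> b < 1 ->
  (b - a) * phi b <= atan_integral_lim b - atan_integral_lim a <= (b - a) * phi a.
Proof.
intros Ha Hab Hb.
assert (Lab := is_lim_seq_minus' _ _ _ _
  (atan_integral_lim_seq b ltac:(lra)) (atan_integral_lim_seq a Ha)).
assert (Lk : forall c, 0 < c < 1 ->
  is_lim_seq (fun n => (b - a) * kernel_integral c (INR (S n))) ((b - a) * phi c)).
{ intros c Hc.
  exact (is_lim_seq_scal_l _ (b - a) _ (kernel_integral_lim_seq c Hc)). }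
(* The comparison is made on [0, M] first; both inequalities then survive the limit along M = n +
   1. *)
assert (S : forall M, 0 <= M ->
  (b - a) * kernel_integral b M <= atan_integral b M - atan_integral a M
    <= (b - a) * kernel_integral a M).
{ intros M HM.
  assert (D := is_RInt_minus _ _ _ _ _ _
    (RInt_correct _ _ _ (ex_RInt_atan_integrand b 0 M))
    (RInt_correct _ _ _ (ex_RInt_atan_integrand a 0 M))).
  assert (P : forall x, 0 < x < M ->
    (b - a) * (x / (1 + (b * x) ^ 2)) / (1 + x ^ 2)
      <= atan_integrand b x - atan_integrand a x
      <= (b - a) * (x / (1 + (a * x) ^ 2)) / (1 + x ^ 2)).
  { intros x Hx.
    assert (A := atan_increment (a * x) (b * x) ltac:(nra) ltac:(nra)).
    assert (0 < / (1 + x ^ 2)) by (apply Rinv_0_lt_compat; nra).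
    unfold atan_integrand, Rdiv in *; rewrite <- Rmult_minus_distr_r.
    split; apply Rmult_le_compat_r; lra. }
  split.
  - apply (is_RInt_le _ _ 0 M _ _ HM (is_RInt_kernel b (b - a) M ltac:(lra)) D).
    intros x Hx; apply P, Hx.
  - apply (is_RInt_le _ _ 0 M _ _ HM D (is_RInt_kernel a (b - a) M ltac:(lra))).
    intros x Hx; apply P, Hx. }
split.
- refine (is_lim_seq_le _ _ (Finite _) (Finite _) _ (Lk b _) Lab); [|lra].
  intros n; apply S, pos_INR.
- refine (is_lim_seq_le _ _ (Finite _) (Finite _) _ Lab (Lk a _)); [|lra].
  intros n; apply S, pos_INR.
Qed.

Lemma is_derive_atan_integral_lim (a : R) : 0 < a < 1 ->
  is_derive atan_integral_lim a (phi a).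
Proof.
intros Ha; apply is_derive_sandwich with 0 1; [exact Ha | |].
- apply continuity_pt_filterlim, (ex_derive_continuous phi); unfold phi.
  auto_derive; repeat split; nra.
- intros x y; apply atan_integral_lim_increment.
Qed.

(* The integral is split at x = 1 / s. *)
Lemma atan_integral_lim_bounds (s : R) : 0 < s ->
  0 <= atan_integral_lim (s ^ 2) <= 3 * s.
Proof.
intros Hs.
assert (Ha : 0 < s ^ 2) by (apply pow_lt, Hs).
assert (Hi : 0 < / s) by (apply Rinv_0_lt_compat, Hs).
assert (H0 : atan_integral (s ^ 2) 0 = 0)
  by (unfold atan_integral; rewrite RInt_point; reflexivity).
assert (B : forall M, 0 <= M -> 0 <= atan_integral (s ^ 2) M <= 3 * s).
{ intros M HM; split.
  - generalize (atan_integral_increment _ 0 M Ha (Rle_refl 0) HM); lra.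
  (* The range up to 1 / s contributes at most s^2 / s = s, and the tail at most 2 s. For M <= 1 /
     s, monotonicity in M already gives s. *)
  - assert (E := atan_integral_le _ (/ s) Ha ltac:(lra)).
    replace (s ^ 2 * / s) with s in E by (field; lra).
    destruct (Rle_dec M (/ s)) as [H | H].
    + generalize (atan_integral_increment _ M (/ s) Ha HM H); lra.
    + assert (I := atan_integral_increment _ (/ s) M Ha ltac:(lra) ltac:(lra)).
      assert (A := atan_tail (/ s) M Hi).
      rewrite Rinv_inv in A; lra. }
assert (L := atan_integral_lim_seq _ Ha).
split.
- refine (is_lim_seq_le _ _ (Finite _) (Finite _) _ (is_lim_seq_const 0) L).
  intros n; apply B, pos_INR.
- refine (is_lim_seq_le _ _ (Finite _) (Finite _) _ L (is_lim_seq_const (3 * s))).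
  intros n; apply B, pos_INR.
Qed.

(** * Comparison of the two sides *)

Definition defect (a : R) : R :=
  2 * atan_integral_lim a
  - (ln a * ln ((1 - a) / (1 + a)) + Li2 a - Li2 (- a)).

(** The term (ln (1 - a) - ln (1 + a)) / a from the product rule cancels against the dilogarithm
    derivatives. What remains of the closed form is - 2 ln a / (1 - a^2), that is 2 [phi a]. *)
Lemma is_derive_defect (a : R) : 0 < a < 1 -> is_derive defect a 0.
Proof.
intros Ha.
assert (Hq : 0 < (1 - a) / (1 + a)) by (apply Rdiv_lt_0_compat; lra).
assert (HF := is_derive_atan_integral_lim a Ha).
assert (HL := is_derive_Li2 a ltac:(apply Rabs_def1; lra) ltac:(lra)).
assert (HLm := is_derive_Li2 (- a) ltac:(apply Rabs_def1; lra) ltac:(lra)).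
unfold defect; auto_derive.
- repeat split; try lra; [exists (phi a) | exists (- ln (1 - a) / a)
    | exists (- ln (1 - - a) / - a)]; assumption.
- rewrite (is_derive_unique (fun x : R => atan_integral_lim x) _ _ HF).
  rewrite (is_derive_unique (fun x : R => Li2 x) _ _ HL).
  rewrite (is_derive_unique (fun x : R => Li2 x) _ _ HLm).
  replace (1 - - a) with (1 + a) by ring.
  replace ((1 + - a) * / (1 + a)) with ((1 - a) / (1 + a)) by (unfold Rdiv; ring).
  rewrite ln_div by lra; unfold phi; field; repeat split; nra.
Qed.

(** Both factors are nonpositive. The first is at least - 2 / s, by ln y <= y - 1 at y = 1 / s, and
    the second is of order s^2, so the product is of order s. *)
Lemma ln_mul_ln_bound (s : R) : 0 < s < 1 / 2 ->
  Rabs (ln (s ^ 2) * ln ((1 - s ^ 2) / (1 + s ^ 2))) <= 8 * s.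
Proof.
intros Hs.
assert (Hi : 0 < / s) by (apply Rinv_0_lt_compat; lra).
assert (H1 : - (2 * / s) <= ln (s ^ 2) <= 0).
{ replace (s ^ 2) with (s * s) by ring; rewrite ln_mult by lra.
  generalize (ln_le_sub1 (/ s) Hi) (ln_le_sub1 s ltac:(lra)).
  rewrite ln_Rinv by lra; lra. }
assert (H2 : - (4 * s ^ 2) <= ln ((1 - s ^ 2) / (1 + s ^ 2)) <= 0).
{ assert (0 < s ^ 2 < 1 / 2) by nra.
  set (y := s ^ 2) in *.
  (* The same inequality is applied to the inverted quotient: it gives 2 y / (1 - y), at most 4 y
     because y < 1/2. *)
  assert (Hp : ln ((1 + y) / (1 - y)) <= 4 * y).
  { apply Rle_trans with ((1 + y) / (1 - y) - 1).
    - apply ln_le_sub1, Rdiv_lt_0_compat; lra.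
    - apply Rmult_le_reg_r with (1 - y); [lra|].
      replace (((1 + y) / (1 - y) - 1) * (1 - y)) with (2 * y) by (field; lra).
      nra. }
  rewrite ln_div in Hp |- * by lra.
  assert (ln (1 - y) <= ln (1 + y)) by (apply ln_le; lra).
  lra. }
rewrite Rabs_pos_eq by nra.
replace (8 * s) with ((2 * / s) * (4 * s ^ 2)) by (field; lra).
nra.
Qed.

(** Zero derivative makes the defect at [a] equal to that at s^2 for all small s > 0, and the latter
    is bounded by a function of s tending to 0. *)
Lemma defect_eq_0 (a : R) : 0 < a < 1 -> defect a = 0.
Proof.
intros Ha.
(* 14 = 2 * 3 + 8: twice the bound 3 s on the integral, plus 8 s for the product of logarithms. *)
set (B := fun s => 14 * s + Rabs (Li2 (s ^ 2) - Li2 (- s ^ 2))).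
assert (HB : forall s, 0 < s < 1 / 2 -> s ^ 2 < a -> Rabs (defect a) <= B s).
{ intros s Hs Hsa.
  rewrite <- (eq_is_derive defect (s ^ 2) a); [| | exact Hsa].
  - assert (F := atan_integral_lim_bounds s ltac:(lra)).
    assert (P := ln_mul_ln_bound s Hs).
    unfold B, defect.
    set (p := ln (s ^ 2) * _) in *; set (L := Li2 (s ^ 2)); set (L' := Li2 _).
    assert (Q := Rle_refl (Rabs (L - L'))).
    apply Rabs_le_between in P; apply Rabs_le_between in Q.
    apply Rabs_le_between; lra.
  - intros t Ht; apply is_derive_defect; assert (0 < s ^ 2) by nra; lra. }
assert (CB : continuity_pt B 0).
{ apply continuity_pt_filterlim.
  assert (C2 : continuous (fun s : R => s ^ 2) 0)
    by (apply (ex_derive_continuous (fun s : R => s ^ 2)); auto_derive; exact I).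
  assert (C3 : continuous (fun s : R => - s ^ 2) 0)
    by (apply (ex_derive_continuous (fun s : R => - s ^ 2)); auto_derive; exact I).
  refine (continuous_plus (V := R_NormedModule) (fun s => 14 * s)
    (fun s => Rabs (Li2 (s ^ 2) - Li2 (- s ^ 2))) 0 _ _).
  - apply (ex_derive_continuous (fun s => 14 * s)); auto_derive; exact I.
  - apply (continuous_comp (fun s => Li2 (s ^ 2) - Li2 (- s ^ 2)) Rabs).
    + refine (continuous_minus (V := R_NormedModule)
        (fun s => Li2 (s ^ 2)) (fun s => Li2 (- s ^ 2)) 0 _ _).
      * apply (continuous_comp (fun s : R => s ^ 2) Li2); [exact C2|].
        replace (0 ^ 2) with 0 by ring; exact continuous_Li2_0.
      * apply (continuous_comp (fun s : R => - s ^ 2) Li2); [exact C3|].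
        replace (- 0 ^ 2) with 0 by ring; exact continuous_Li2_0.
    + apply continuity_pt_filterlim, Rcontinuity_abs. }
assert (B0 : B 0 = 0).
{ unfold B; replace (- 0 ^ 2) with 0 by ring; replace (0 ^ 2) with 0 by ring.
  rewrite Li2_0, Rminus_0_r, Rabs_R0; ring. }
destruct (Req_dec (defect a) 0) as [H | H]; [exact H | exfalso].
destruct (CB _ (Rabs_pos_lt _ H)) as [d [Hd Hlim]].
(* d / 2 puts s within the continuity modulus, 1 / 4 below the required 1 / 2, and s <= a with s <=
   1 / 4 yields s^2 < a. Then |defect a| <= B s < |defect a|, a contradiction. *)
set (s := Rmin (d / 2) (Rmin (1 / 4) a)).
assert (S : 0 < s /\ s <= d / 2 /\ s <= 1 / 4 /\ s <= a).
{ unfold s; repeat split.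
  - repeat apply Rmin_glb_lt; lra.
  - apply Rmin_l.
  - eapply Rle_trans; [apply Rmin_r | apply Rmin_l].
  - eapply Rle_trans; [apply Rmin_r | apply Rmin_r]. }
assert (E := HB s ltac:(lra) ltac:(nra)).
assert (K : Rabs (B s - B 0) < Rabs (defect a)).
{ apply Hlim; split.
  - split; [exact I | lra].
  - simpl; unfold Rdist; rewrite Rabs_pos_eq; lra. }
apply Rabs_def2 in K; lra.
Qed.

Theorem proposition1 (alpha : R) (h0 : 0 < alpha) (h1 : alpha < 1) :
  ex_RInt_gen (fun x : R => atan (alpha * x) / (1 + x ^ 2))
    (at_point 0) (Rbar_locally p_infty)
  /\
  2 * RInt_gen (fun x : R => atan (alpha * x) / (1 + x ^ 2))
        (at_point 0) (Rbar_locally p_infty)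
  = ln alpha * ln ((1 - alpha) / (1 + alpha)) + Li2 alpha - Li2 (- alpha).
Proof.
split.
- exact (ex_RInt_gen_atan_integrand alpha h0).
- assert (D := defect_eq_0 alpha (conj h0 h1)).
  unfold defect, atan_integral_lim, atan_integrand in D; lra.
Qed.
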